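(* For $n\ge 0$, let $v_n$ be the total number of pairs $(T,P)$, where $T$ is a tiling of the $(1\times n)$-board by $(1\times 1)$-squares and $(1\times 2)$-dominoes, and $P$ is a shortest lattice walk crossing the tiled board in the sense described in the context. Then $$n\,v_n=(n+1)\,v_{n-1}+(n+2)\,v_{n-2}\qquad\text{for all } n\ge 2,$$ with $v_0=1$ and $v_1=2$.
   Context: The $(1\times n)$-board is the rectangle $[0,n]\times[0,1]$ subdivided into $n$ unit cells; its grid segments are the unit edges of these cells. A tiling covers the board with non-overlapping unit squares and dominoes, a domino being the union of two horizontally adjacent cells. Given a tiling, a walk crossing the board is a path along grid segments from the lower-left corner $(0,0)$ to the upper-right corner $(n,1)$ of shortest possible length, i.e. of length $n+1$, consisting of unit right and up steps. The walk may not use any grid segment lying in the interior of a domino, i.e. the segment separating the two cells of a domino. For $n=0$ the board is the single segment from $(0,0)$ to $(0,1)$, there is one empty tiling, and exactly one walk. *)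

(* Defs.v *)
From HB Require Import structures.
From mathcomp Require Import all_boot.

Set Implicit Arguments.
Unset Strict Implicit.
Unset Printing Implicit Defensive.

(* The cell [i, i+1] x [0, 1] of the (1 x n)-board is represented by its index
   i : 'I_n, and a tile by the set of cells it covers. *)

Definition is_square n (t : {set 'I_n}) : bool :=
  [exists i : 'I_n, t == [set i]].

Definition is_domino n (t : {set 'I_n}) : bool :=
  [exists i : 'I_n, exists j : 'I_n, (j == i.+1 :> nat) && (t == [set i; j])].

Definition is_tiling n (T : {set {set 'I_n}}) : bool :=
  partition T [set: 'I_n] && [forall t in T, is_square t || is_domino t].

(* Vertices (x, y) of the grid, with 0 <= x <= n and 0 <= y <= 1. *)
Definition vertex n : finType := ('I_n.+1 * 'I_2)%type.

Definition right_step n (p q : vertex n) : bool :=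
  (q.1 == p.1.+1 :> nat) && (q.2 == p.2).

Definition up_step n (p q : vertex n) : bool :=
  (q.1 == p.1) && (q.2 == p.2.+1 :> nat).

(* The segment from p to q separates the cells j-1 and j of a domino of T,
   i.e., it is the vertical segment of abscissa j. *)
Definition inside_domino n (T : {set {set 'I_n}}) (p q : vertex n) : bool :=
  (p.1 == q.1) &&
  [exists i : 'I_n, exists j : 'I_n,
     [&& j == i.+1 :> nat, [set i; j] \in T & p.1 == j :> nat]].

Definition walk_step n (T : {set {set 'I_n}}) (p q : vertex n) : bool :=
  (right_step p q || up_step p q) && ~~ inside_domino T p q.

(* The tuple lists the n + 1 vertices visited after the starting vertex. *)
Definition is_walk n (T : {set {set 'I_n}}) (w : n.+1.-tuple (vertex n)) : bool :=
  path (walk_step T) (ord0, ord0) w &&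
  (last (ord0, ord0) w == (ord_max, ord_max)).

Definition v (n : nat) : nat :=
  #|[set TP : {set {set 'I_n}} * n.+1.-tuple (vertex n) |
      is_tiling TP.1 && is_walk TP.1 TP.2]|.

(* Main.v *)
Require Import Defs.
From mathcomp Require Import all_boot.
From mathcomp Require Import zify.

(** A walk is determined by the abscissa x of its only vertical step, which must
    be a break of the tiling; a tiling with a break at x is a tiling of the
    first x cells together with one of the remaining n - x. With f_n the number
    of tilings, v_n is therefore the convolution sum_x f_x f_(n-x), and the
    Fibonacci recurrence of f gives v_n = v_(n-1) + v_(n-2) + f_n. The theorem
    then amounts to n f_n = v_(n-1) + 2 v_(n-2), which follows by two-step
    induction. *)

Set Implicit Arguments.
Unset Strict Implicit.
Unset Printing Implicit Defensive.

(** * Encodings of tilings and walks *)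

Definition nonadjacent (a b : bool) : bool := ~~ (a && b).

(** The second condition of [inside_domino] at abscissa [x], in convertible form. *)
Definition cut n (T : {set {set 'I_n}}) (x : nat) : bool :=
  [exists i : 'I_n, exists j : 'I_n,
     [&& j == i.+1 :> nat, [set i; j] \in T & x == j :> nat]].

(* The k-th entry of the code of a tiling tells whether the cells k - 1 and k
   form a domino. *)
Definition code n (T : {set {set 'I_n}}) : n.-tuple bool :=
  [tuple cut T i | i < n].

(* Two cells lie in the same tile when their tiles have the same leftmost
   cell. *)
Definition tiling_of n (b : n.-tuple bool) : {set {set 'I_n}} :=
  preim_partition (fun i : 'I_n => i - nth false b i) [set: 'I_n].

(** The walk with vertical step at abscissa [x]. Entry [k] is the vertex reached after [k.+1]
    steps. *)
Definition walk_of n (x : 'I_n.+1) : n.+1.-tuple (vertex n) :=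
  [tuple if k < x then (inord k.+1, ord0) else (k, ord_max) | k < n.+1].

(** The letter [a] stands before the word. No domino ends at the first cell, so tilings correspond
    to [a = true], and [codes true n] is f_n. *)
Definition codes (a : bool) (n : nat) : nat :=
  #|[set b : n.-tuple bool | path nonadjacent a b]|.

Definition cut_codes (a : bool) (m k : nat) : nat :=
  #|[set b : (m + k).-tuple bool | path nonadjacent a b & ~~ nth false b m]|.

(** * Counting codes *)

Lemma card_tupleS n (P : seq bool -> bool) :
  #|[set b : n.+1.-tuple bool | P b]| =
  #|[set b : n.-tuple bool | P (false :: b)]| +
  #|[set b : n.-tuple bool | P (true :: b)]|.
Proof.
rewrite -!sum1_card big_mkcond /=.
rewrite (reindex (fun p : bool * n.-tuple bool => [tuple of p.1 :: p.2])) /=;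
  last first.
  exists (fun t => (thead t, [tuple of behead t])) => [[a t] _|t _] /=.
    by congr pair; apply: val_inj.
  by rewrite [RHS]tuple_eta; apply: val_inj.
rewrite -(pair_big xpredT xpredT (fun (a : bool) (t : n.-tuple bool) =>
  if [tuple of a :: t] \in [set b : n.+1.-tuple bool | P b] then 1 else 0)) /=.
rewrite big_bool /= addnC.
by congr (_ + _); rewrite [RHS]big_mkcond; apply: eq_bigr => t _; rewrite !inE.
Qed.

Lemma codes0 a : codes a 0 = 1.
Proof.
rewrite /codes (_ : [set _ | _] = [set [tuple]]) ?cards1 //.
by apply/setP => b; rewrite !inE (tuple0 b) eqxx.
Qed.

Lemma codes_trueS n : codes true n.+1 = codes false n.
Proof.
rewrite /codes card_tupleS /=.
by rewrite [X in _ + X](_ : _ = 0) ?addn0 //; apply: eq_card0 => b; rewrite inE.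
Qed.

Lemma codes1 : codes true 1 = 1.
Proof. by rewrite codes_trueS codes0. Qed.

Lemma codes_falseS n : codes false n.+1 = codes false n + codes true n.
Proof. by rewrite /codes card_tupleS. Qed.

Lemma codes_trueSS n :
  codes true n.+2 = codes true n.+1 + codes true n.
Proof. by rewrite !codes_trueS codes_falseS. Qed.

(** A [false] at position [m] does not constrain the letters before it, and for those after it the
    effect is that of a preceding [true]. So the two parts of the word are independent. *)
Lemma cut_codesE a m k : cut_codes a m k = codes a m * codes true k.
Proof.
elim: m a => [|m IHm] a.
  rewrite codes0 mul1n; apply: eq_card => b; rewrite !inE.
  by case: (tval b) => [|[] s] //=; rewrite ?andbF ?andbT // /nonadjacent andbF.
rewrite /cut_codes addSn.
rewrite (card_tupleS _ (fun b => path nonadjacent a b && ~~ nth false b m.+1)) /=.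
have {1}-> : nonadjacent a false by rewrite /nonadjacent andbF.
rewrite -[X in X + _]/(cut_codes false m k) IHm.
case: a.
  rewrite codes_trueS [X in _ + X](_ : _ = 0) ?addn0 //.
  by apply: eq_card0 => b; rewrite inE.
by rewrite -[X in _ + X]/(cut_codes true m k) IHm codes_falseS mulnDl.
Qed.

(** * Bijection between tilings and codes *)

Section Tilings.

Variable n : nat.
Implicit Types (T : {set {set 'I_n}}) (b : n.-tuple bool).

Lemma cutP T (x : nat) :
  reflect (exists i j : 'I_n,
             [/\ j = i.+1 :> nat, [set i; j] \in T & x = j :> nat]) (cut T x).
Proof.
apply: (iffP existsP) => [[i /existsP[j /and3P[/eqP ? ? /eqP ?]]]|].
  by exists i, j.
case=> i [j [ji Tij ->]]; exists i; apply/existsP; exists j.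
by rewrite ji Tij !eqxx.
Qed.

(** For [x >= n] no domino straddles [x], in agreement with the default [false]; [x = n] is a
    possible abscissa of the vertical step. *)
Lemma nth_code T x : nth false (code T) x = cut T x.
Proof.
have [xn|nx] := ltnP x n.
  by rewrite -[x]/(nat_of_ord (Ordinal xn)) -tnth_nth tnth_mktuple.
rewrite nth_default ?size_tuple //; apply/esym/cutP => -[i [j [_ _ xj]]].
by have := ltn_ord j; lia.
Qed.

Lemma nonadjacentP b :
  reflect (~~ nth false b 0 /\
           forall k, nth false b k.+1 -> ~~ nth false b k)
          (path nonadjacent true b).
Proof.
apply: (iffP (pathP false)) => [H|[b0 bS] [|k] kb]; last 2 first.
- by rewrite /= /nonadjacent.
- rewrite /= /nonadjacent negb_and orbC -implybE; exact/implyP/bS.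
split=> [|k bk].
  by case: (ltnP 0 (size b)) => [/H|/(nth_default _)->].
case: (ltnP k.+1 (size b)) => [/H|/(nth_default false) bF]; last by rewrite bF in bk.
by rewrite /= /nonadjacent bk andbT.
Qed.

Lemma tiles_disjoint T (s t : {set 'I_n}) (i : 'I_n) :
  is_tiling T -> s \in T -> t \in T -> i \in s -> i \in t -> s = t.
Proof.
case/andP=> /and3P[_ /trivIsetP tT _] _ sT tT' si ti.
apply/eqP/contraT => /(tT _ _ sT tT') /disjoint_setI0 st0.
by have := in_set0 i; rewrite -st0 inE si ti.
Qed.

Lemma code_nonadjacent T : is_tiling T -> path nonadjacent true (code T).
Proof.
move=> tT; apply/nonadjacentP; split=> [|k]; rewrite !nth_code.
  by apply/cutP => -[i [j [-> _]]].
case/cutP=> i [j [ji Tij kj]]; apply/cutP => -[i' [j' [ji' Tij' kj']]].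
(* Dominoes ending at two consecutive cells would overlap in [i]. *)
have ej : j' = i by apply: val_inj => /=; lia.
have := tiles_disjoint (i := i) tT Tij Tij'.
rewrite ej !inE eqxx orbT => /(_ isT isT)/setP/(_ j).
by rewrite !inE eqxx orbT -!val_eqE /=; lia.
Qed.

Lemma mem_tiling_of b (i : 'I_n) (t : {set 'I_n}) :
  (forall k : 'I_n, (i - nth false b i == k - nth false b k) = (k \in t)) ->
  t \in tiling_of b.
Proof.
move=> et; apply/imsetP; exists i => //.
by apply/setP => k; rewrite !inE et.
Qed.

Lemma tiling_ofP b (t : {set 'I_n}) : t \in tiling_of b ->
  exists i : 'I_n, t = [set k : 'I_n | i - nth false b i == k - nth false b k].
Proof.
rewrite /tiling_of /preim_partition /equivalence_partition.
by case/imsetP=> i _ ->; exists i; apply/setP => k; rewrite !inE.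
Qed.

(** The subtraction moves the right cell of a domino to its left cell and fixes every other cell.
    Without adjacent [true] entries, no class exceeds two cells. *)
Lemma same_tile b (i k : nat) : path nonadjacent true b ->
  (i - nth false b i == k - nth false b k) =
  [|| k == i, (k == i.+1) && nth false b k | (i == k.+1) && nth false b i].
Proof.
case/nonadjacentP=> b0 bS.
have [->|ki] := eqVneq k i; first by rewrite eqxx.
have [ei|ki1] := eqVneq k i.+1.
  have := bS i; rewrite ei.
  by case: (nth _ b i.+1) => [/(_ isT)/negbTE->|_]; last case: (nth _ b i); lia.
have [ei|ik1] := eqVneq i k.+1.
  have := bS k; rewrite ei.
  by case: (nth _ b k.+1) => [/(_ isT)/negbTE->|_]; last case: (nth _ b k); lia.
by case: i b0 ki ki1 ik1 => [|i]; case: k => [|k] //=;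
  case: (nth _ b _); case: (nth _ b _) => //=; lia.
Qed.

Lemma domino_tiling_of b (i j : 'I_n) : path nonadjacent true b ->
  j = i.+1 :> nat -> ([set i; j] \in tiling_of b) = nth false b j.
Proof.
move=> vb ji; apply/idP/idP => [/tiling_ofP[k ek]|bj].
  have := in_set2 i i j; have := in_set2 j i j.
  rewrite ek !inE !eqxx orbT => /eqP ej /eqP ei.
  have /eqP := etrans (esym ei) ej; rewrite same_tile // ji eqxx /=.
  by case/or3P=> //; lia.
apply: (mem_tiling_of (i := i)) => k.
rewrite !inE same_tile // -!val_eqE /=.
case/nonadjacentP: vb => _ /(_ i); rewrite -ji bj => /(_ isT)/negbTE->.
rewrite andbF orbF; case: eqP => //= _.
by case: eqP => //= ->; rewrite bj.
Qed.

Lemma code_tiling_of b : path nonadjacent true b -> code (tiling_of b) = b.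
Proof.
move=> vb; apply: eq_from_tnth => x; rewrite !(tnth_nth false) nth_code.
apply/cutP/idP => [[i [j [ji]]]|bx].
  by rewrite domino_tiling_of // => + ->.
have [b0 _] := nonadjacentP _ vb.
case: x bx => [[|x] xn] /= bx; first by rewrite bx in b0.
exists (Ordinal (ltnW xn)), (Ordinal xn); split=> //.
by rewrite domino_tiling_of.
Qed.

(** The class of [i] is a domino ending at [i] if entry [i] is [true], a domino starting at [i] if
    entry [i.+1] is, and a square otherwise. *)
Lemma tiling_of_is_tiling b :
  path nonadjacent true b -> is_tiling (tiling_of b).
Proof.
move=> vb; apply/andP; split; first exact: preim_partitionP.
have [b0 bS] := nonadjacentP _ vb.
apply/forall_inP => t tb; have [i et] := tiling_ofP tb.
case bi: (nth false b i).
  case: i bi et => [[|i] iltn] /= bi et; first by rewrite bi in b0.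
  apply/orP; right; apply/existsP; exists (Ordinal (ltnW iltn)).
  apply/existsP; exists (Ordinal iltn); rewrite eqxx /=.
  rewrite et; apply/eqP/setP => k; rewrite !inE same_tile // -!val_eqE /= bi.
  case bk : (nth false b k); rewrite ?andbT ?andbF ?orbF; last by lia.
  have ki : k != i.+2 :> nat.
    by apply/eqP => ki; have := bS i.+1; rewrite -ki bk bi => /(_ isT).
  by lia.
case bi1: (nth false b i.+1).
  have iltn : i.+1 < n.
    by case: ltnP bi1 => // ni; rewrite nth_default ?size_tuple.
  apply/orP; right; apply/existsP; exists i; apply/existsP.
  exists (Ordinal iltn); rewrite eqxx /= et.
  apply/eqP/setP => k; rewrite !inE same_tile // -!val_eqE /= bi andbF orbF.
  by have [->|] := eqVneq (k : nat) i.+1; rewrite ?bi1.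
apply/orP; left; apply/existsP; exists i; rewrite et.
apply/eqP/setP => k; rewrite !inE same_tile // -!val_eqE /= bi andbF orbF.
by have [ki|] := eqVneq (k : nat) i.+1; rewrite ?ki ?bi1 ?andbF ?orbF.
Qed.

(** One inclusion suffices: a tile of [tiling_of (code T)] meets some tile of [T], which by this
    inclusion lies in the same partition, so the two coincide. *)
Lemma tiling_of_code T : is_tiling T -> tiling_of (code T) = T.
Proof.
move=> tT; have vT := code_nonadjacent tT.
have sub t : t \in T -> t \in tiling_of (code T).
  move=> Tt; have /andP[_ /forall_inP /(_ _ Tt)] := tT.
  case/orP => /existsP[i]; last first.
    case/existsP=> j /andP[/eqP ji /eqP et].
    rewrite et domino_tiling_of // nth_code; apply/cutP; exists i, j.
    by split; rewrite // -et.
  move=> /eqP et.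
  have no_domino (x y : 'I_n) : y = x.+1 :> nat ->
      [set x; y] \in T -> i \notin [set x; y].
    move=> yx Txy; apply/negP => ixy.
    have := @tiles_disjoint T _ _ i tT Txy Tt ixy; rewrite et inE eqxx.
    move=> /(_ isT)/setP exy; have := exy x; have := exy y.
    by rewrite !inE !eqxx orbT -!val_eqE /=; lia.
  apply: (mem_tiling_of (i := i)) => k; rewrite et inE same_tile // !nth_code -!val_eqE /=.
  have [//|ki] := eqVneq (k : nat) i; apply/negbTE => /=.
  apply/norP; split; apply/negP => /andP[/eqP ei] /cutP[x [y [yx Txy ky]]];
    by have := no_domino _ _ yx Txy; rewrite !inE -!val_eqE /=; lia.
apply/setP => t; apply/idP/idP => [tb|]; last exact: sub.
have tC := tiling_of_is_tiling vT.
have [i et] := tiling_ofP tb.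
have it : i \in t by rewrite et inE.
have /andP[pT _] := tT.
have ic : i \in cover T by rewrite (cover_partition pT) inE.
rewrite (@tiles_disjoint _ t (pblock T i) i tC) ?pblock_mem //.
  exact/sub/pblock_mem.
by rewrite mem_pblock.
Qed.

(** * Bijection between walks and breaks *)

Lemma nth_walk_of (x : 'I_n.+1) p k : k < n.+1 ->
  nth p (walk_of x) k =
  if k < x then (inord k.+1, ord0) else (inord k, ord_max).
Proof.
move=> kn; rewrite -[k]/(nat_of_ord (Ordinal kn)) -tnth_nth tnth_mktuple /=.
by case: ifP => // _; rewrite (_ : inord k = Ordinal kn) //; apply: val_inj; rewrite /= inordK.
Qed.

Lemma walk_of_inj : injective (@walk_of n).
Proof.
suff H (x y : 'I_n.+1) : walk_of x = walk_of y -> x <= y.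
  by move=> x y e; apply/val_inj/eqP; rewrite eqn_leq !H.
move=> e; rewrite leqNgt; apply/negP => yx.
(* At entry [y], the walk of [y] is already in the top row while that of [x] is still in the bottom
   row. *)
have := nth_walk_of x (ord0, ord0) (ltn_ord y).
by rewrite e nth_walk_of ?ltn_ord // ltnn yx.
Qed.

Lemma walk_of_is_walk T (x : 'I_n.+1) : ~~ cut T x -> is_walk T (walk_of x).
Proof.
move=> cx; apply/andP; split; last first.
  rewrite (last_nth (ord0, ord0)) size_tuple /= nth_walk_of //.
  rewrite ltnNge -ltnS ltn_ord /=; apply/eqP; congr pair.
  by apply: val_inj; rewrite /= inordK.
have xn := ltn_ord x.
(* The starting vertex is not in the tuple, so the first step is treated apart. *)
apply/(pathP (ord0, ord0)) => -[|k]; rewrite size_tuple => kn.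
  rewrite nth_walk_of //= /walk_step /right_step /up_step /inside_domino /=.
  case: ltnP => x0 /=; rewrite -!val_eqE /= ?inordK //; try lia.
  have x00 : x = 0 :> nat by lia.
  by move: cx; rewrite x00 -[[exists _, _]]/(cut T 0) => ->.
rewrite /= !nth_walk_of //; last by lia.
rewrite /walk_step /right_step /up_step /inside_domino.
case: (ltnP k x) => kx; case: (ltnP k.+1 x) => k1x /=; rewrite -!val_eqE /= ?inordK //; try lia.
have -> : k.+1 = x by lia.
by rewrite eqxx /= orbT /=; exact: cx.
Qed.

(** The coordinates of the vertex after [k] steps add up to [k], and the height grows from 0 to 1,
    so the first step [x] reaching height 1 determines the walk. This step is vertical at abscissa
    [x], hence no domino straddles [x]. *)
Lemma is_walk_walk_of T (w : n.+1.-tuple (vertex n)) : is_walk T w ->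
  exists2 x : 'I_n.+1, ~~ cut T x & w = walk_of x.
Proof.
case/andP=> pw lw.
pose p0 : vertex n := (ord0, ord0).
pose u k := nth p0 (p0 :: w) k.
have step k : k < n.+1 -> walk_step T (u k) (u k.+1).
  by move=> kn; move/(pathP p0): pw => /(_ k); rewrite size_tuple; apply.
have uD k : k <= n.+1 -> (u k).1 + (u k).2 = k.
  elim: k => // k IHk kn; have := IHk (ltnW kn); have /andP[+ _] := step k kn.
  by rewrite /right_step /up_step -!val_eqE /=; lia.
have umono k l : k <= l -> l <= n.+1 -> (u k).2 <= (u l).2.
  move=> /subnKC <-; elim: (l - k) => [|d IHd] kn; first by rewrite addn0.
  have kd : k + d < n.+1 by lia.
  apply: leq_trans (IHd (ltnW kd)) _; rewrite addnS.
  have /andP[+ _] := step _ kd.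
  by rewrite /right_step /up_step -!val_eqE /=; lia.
have un : (u n.+1).2 = 1 :> nat.
  have := lw; rewrite (last_nth p0) size_tuple -/(u n.+1).
  by move=> /eqP ->.
pose P k := (u k.+1).2 == 1 :> nat.
have exP : exists k, P k by exists n; rewrite /P un.
case: (ex_minnP exP) => x Px minx.
have xn : x < n.+1 by rewrite ltnS; apply: minx; rewrite /P un.
have u2 k : k < n.+1 -> (u k.+1).2 = (x <= k) :> nat.
  move=> kn; have := ltn_ord (u k.+1).2; case: (leqP x k) => xk.
    by have := umono x.+1 k.+1 xk kn; move: Px; rewrite /P; lia.
  by have := minx k; rewrite /P; lia.
have wx : w = walk_of (Ordinal xn).
  apply/val_inj/(@eq_from_nth _ p0); rewrite ?size_tuple // => k kn.
  rewrite nth_walk_of //= -[nth _ _ _]/(u k.+1).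
  have := uD k.+1 kn; have := u2 k kn; case: (u k.+1) => a c /=.
  by case: (ltnP k x) => kx ec ea; congr pair; apply: val_inj; rewrite /= ?inordK; lia.
exists (Ordinal xn) => //=.
have /andP[_] := step x xn; rewrite /inside_domino.
have u2x : (u x).2 = 0 :> nat.
  have [->//|x_gt0] := posnP x.
  by have := u2 x.-1; rewrite prednK // => ->; lia.
have := uD x (ltnW xn); have := uD x.+1 xn; have := u2 x xn.
rewrite leqnn => ux2 e1 e2.
have ex : (u x).1 = x :> nat by lia.
rewrite -[[exists _, _]]/(cut T (u x).1) ex.
by have /val_inj/eqP -> : (u x).1 = (u x.+1).1 :> nat by lia.
Qed.

Lemma card_walks T :
  #|[set w | is_walk T w]| = #|[set x : 'I_n.+1 | ~~ cut T x]|.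
Proof.
rewrite -(card_imset _ walk_of_inj); apply: eq_card => w; rewrite inE.
apply/idP/imsetP => [/is_walk_walk_of[x cx ->]|[x + ->]].
  by exists x; rewrite ?inE.
by rewrite inE => /walk_of_is_walk.
Qed.

End Tilings.

(** * The convolution and the recurrences *)

Lemma card_cut_codes n (x : 'I_n.+1) :
  #|[set b : n.-tuple bool | path nonadjacent true b & ~~ nth false b x]| =
  codes true x * codes true (n - x).
Proof.
rewrite -cut_codesE /cut_codes.
move: (nat_of_ord x) (ltn_ord x) => {}x; rewrite ltnS => xn.
(* Generalizing the length allows it to be replaced by [n] inside the tuple type. *)
by move: (x + (n - x)) (subnKC xn) => m ->.
Qed.

Lemma v_convolution n :
  v n = \sum_(x < n.+1) codes true x * codes true (n - x).
Proof.
transitivity (\sum_(T : {set {set 'I_n}} | is_tiling T)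
                #|[set w | is_walk T w]|).
  rewrite /v -sum1_card; under [RHS]eq_bigr do rewrite -sum1_card.
  by rewrite pair_big_dep /=; apply: eq_bigl => -[T w]; rewrite !inE.
under eq_bigr do rewrite card_walks.
rewrite (reindex_onto (@tiling_of n) (@code n)) /=; last exact: tiling_of_code.
transitivity (\sum_(b : n.-tuple bool | path nonadjacent true b)
                \sum_(x < n.+1 | ~~ nth false b x) 1).
  apply: eq_big => [b|b /andP[_ /eqP eb]].
    apply/andP/idP => [[tb /eqP <-]|vb]; first exact: code_nonadjacent.
    by rewrite tiling_of_is_tiling // code_tiling_of.
  rewrite -sum1_card; apply: eq_bigl => x.
  by rewrite inE -nth_code eb.
(* For a fixed abscissa [x], the codes with a break at [x] remain to be counted. *)
rewrite (exchange_big_dep xpredT) //=; apply: eq_bigr => x _.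
rewrite -card_cut_codes -sum1_card.
by apply: eq_bigl => b; rewrite inE.
Qed.

Lemma v0 : v 0 = 1.
Proof. by rewrite v_convolution big_ord1 codes0. Qed.

Lemma v1 : v 1 = 2.
Proof. by rewrite v_convolution big_ord_recl big_ord1 /= codes_trueS !codes0. Qed.

Lemma vSS n : v n.+2 = v n.+1 + v n + codes true n.+2.
Proof.
(* The Fibonacci rule applies to f_(n+2-x) only for x <= n, so the terms beyond are split off. Those
   equal to f_(n+1) cancel because f_0 = f_1 = 1. *)
rewrite !v_convolution big_ord_recr /= big_ord_recr /=.
rewrite [\sum_(x < n.+2) _]big_ord_recr /=.
rewrite subnn (_ : n.+2 - n.+1 = 1) ?subnn; last lia.
rewrite codes1 codes0 !muln1.
rewrite (eq_bigr (fun x : 'I_n.+1 => codes true x * codes true (n.+1 - x) +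
  codes true x * codes true (n - x))) ?big_split /=; first lia.
move=> x _; have xn : x <= n by rewrite -ltnS.
by rewrite (subSn (leqW xn)) (subSn xn) codes_trueSS mulnDr.
Qed.

Lemma codes_v n : n.+2 * codes true n.+2 = v n.+1 + 2 * v n.
Proof.
suff [] : n.+2 * codes true n.+2 = v n.+1 + 2 * v n /\
          n.+3 * codes true n.+3 = v n.+2 + 2 * v n.+1 by [].
elim: n => [|n [IHn IHn1]].
  by rewrite vSS !codes_trueSS codes1 codes0 v0 v1.
(* (n+4) f_(n+4) = (n+3) f_(n+3) + (n+2) f_(n+2) + f_(n+3) + 2 f_(n+2), and the last two terms are
   those that [vSS] adds to the induction hypotheses. *)
split=> //; have := codes_trueSS n.+2; have := vSS n; have := vSS n.+1; lia.
Qed.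

Theorem theorem1 :
  [/\ v 0 = 1, v 1 = 2 &
      forall n : nat, 2 <= n ->
        n * v n = (n + 1) * v (n - 1) + (n + 2) * v (n - 2)].
Proof.
split; [exact: v0 | exact: v1 |] => -[|[|n]] // _.
rewrite subn1 subn2 /=.
(* Multiply [vSS] by n+2 and substitute [codes_v] for (n+2) f_(n+2). *)
have := codes_v n; have := vSS n; nia.
Qed.
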